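(* Let $0<\varepsilon\ll1$, $\Omega_0>0$ and $\hat\alpha,\Delta,\Omega,\hat P_N,\kappa,q\in\mathbb R$, and consider on $X=\mathbb C\times\mathbb S^1\times\mathbb R$ the system $$\begin{cases}\dot z=i\Omega_0z+\varepsilon\Bigl(\bigl(i\Delta-\tfrac{\hat\alpha}{2}\bigr)z-\dfrac{\kappa q}{2\Omega_0}e^{i\psi}\Bigr),\\ \dot\psi=\Omega_0+\varepsilon w,\\ \dot w=\varepsilon\bigl(\hat P_N-\hat\alpha(\Omega+w)\bigr).\end{cases}$$ This system admits a nontrivial relative equilibrium with $z^*\ne0$ if and only if $$\hat\alpha\neq0,\qquad \kappa q\ne0.$$ Under these conditions, the relative equilibrium has a representative in the cross-section $\Sigma=\{(z,\psi,w):z=x\in\mathbb R^+\}$ given by $u^\Sigma=(x^*,\psi^*,w^* )$, where $$w^*=\frac{\hat P_N}{\hat\alpha}-\Omega,\qquad x^*=\left|\frac{\kappa q}{\Omega_0\sqrt{\hat\alpha^2+4\left(\frac{\hat P_N}{\hat\alpha}-\Omega-\Delta\right)^2}}\right|,$$ $$\cos\psi^*=-\operatorname{sgn}(\kappa q)\frac{\hat\alpha}{\sqrt{\hat\alpha^2+4\left(\frac{\hat P_N}{\hat\alpha}-\Omega-\Delta\right)^2}},\qquad \sin\psi^*=-\operatorname{sgn}(\kappa q)\frac{2\left(\frac{\hat P_N}{\hat\alpha}-\Omega-\Delta\right)}{\sqrt{\hat\alpha^2+4\left(\frac{\hat P_N}{\hat\alpha}-\Omega-\Delta\right)^2}}.$$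 Its group velocity is $$\xi^*=1+\frac{\varepsilon}{\Omega_0}w^*.$$ The full relative equilibrium is the $S^1$-orbit of $u^\Sigma$ generated by the symmetry action.
   Context: $\mathbb S^1=\mathbb R/2\pi\mathbb Z$ and $\mathbb R^+=(0,\infty)$. The symmetry action is $R_\theta(z,\psi,w)=(e^{i\Omega_0\theta}z,\ \psi+\Omega_0\theta,\ w)$, $\theta\in\mathbb R$ (periodic in $\theta$ with period $2\pi/\Omega_0$, hence a circle action), under which the system is equivariant. A point $u^*=(z^*,\psi^*,w^* )\in X$ is a relative equilibrium with group velocity $\xi\in\mathbb R$ if the solution $\Phi_t(u^* )$ of the system starting at $u^*$ satisfies $\Phi_t(u^* )=R_{\xi t}(u^* )$ for all $t\in\mathbb R$; points on the same $R_\theta$-orbit represent the same relative equilibrium.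
   Formalization: The existence criterion excludes α̂ = P̂_N = 0, where w is constant and nontrivial relative equilibria always exist, so the criterion as stated fails; for all parameters it is also shown that exactly one such relative equilibrium (orbit) exists iff α̂ ≠ 0 and κq ≠ 0. *)

(* Defs.v *)
From HB Require Import structures.
From mathcomp Require Import all_boot all_order all_algebra.
From mathcomp Require Import generic_quotient ring_quotient.
From mathcomp Require Import all_classical all_reals all_analysis.
From mathcomp Require Import complex.

Set Implicit Arguments.
Unset Strict Implicit.
Unset Printing Implicit Defensive.

Import Order.TTheory GRing.Theory Num.Theory numFieldNormedType.Exports.

Local Open Scope classical_set_scope.
Local Open Scope ring_scope.

Definition twopiZ (R : realType) (x : R) : bool := x / (pi *+ 2) \is a Num.int.

Lemma twopiZ_closed (R : realType) : zmod_closed (@twopiZ R).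
Proof.
split=> [|x y hx hy]; first by change (0 / (pi *+ 2) \is a (@Num.int R)); rewrite mul0r rpred0.
by change ((x - y) / (pi *+ 2) \is a (@Num.int R)); rewrite mulrBl; exact: rpredB.
Qed.

HB.instance Definition _ (R : realType) :=
  GRing.isZmodClosed.Build R (@twopiZ R) (twopiZ_closed R).

Definition twopiZ_group (R : realType) : zmodClosed R :=
  GRing.ZmodClosed.clone R (@twopiZ R) _.

Notation S1 R := (Quotient.quot (twopiZ_group R)).

Definition toS1 (R : realType) (x : R) : S1 R := (\pi_(S1 R) x)%qT.

Lemma toS1D (R : realType) (x y : R) : toS1 (x + y) = toS1 x + toS1 y.
Proof. exact: pi_addr. Qed.

(* The value of cos and sin at an angle is computed on a representative;
   cosS1E and sinS1E show that the choice is immaterial. *)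
Definition cosS1 (R : realType) (psi : S1 R) : R := cos (repr psi).
Definition sinS1 (R : realType) (psi : S1 R) : R := sin (repr psi).

Lemma toS1_eqP (R : realType) (x y : R) :
  toS1 x = toS1 y <-> exists k : int, x = y + k%:~R * (pi *+ 2).
Proof.
have pi2 : (pi *+ 2 : R) != 0 by rewrite mulrn_eq0 /= gt_eqF ?pi_gt0.
have -> : (toS1 x = toS1 y) <-> (x - y) / (pi *+ 2) \is a Num.int.
  have piE : twopiZ (x - y) = (toS1 x == toS1 y).
    exact: (Quotient.idealrBE (twopiZ_group R) x y).
  by rewrite -/(twopiZ (x - y)) piE; split=> /eqP.
split=> [/intrP[k hk]|[k ->]].
  by exists k; rewrite -hk divfK // addrC subrK.
by rewrite addrC addKr mulfK // intr_int.
Qed.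

Lemma periodicz (R : realType) (f : R -> R) (T : R) (k : int) :
  periodic f T -> forall x, f (x + k%:~R * T) = f x.
Proof.
move=> fT x; case: k => n; first by rewrite -pmulrn mulr_natl periodicn.
by rewrite NegzE mulrNz mulNr -pmulrn mulr_natl -[in RHS](subrK (T *+ n.+1) x) periodicn.
Qed.

Lemma cosS1E (R : realType) (x : R) : cosS1 (toS1 x) = cos x.
Proof.
have /toS1_eqP[k kE] : toS1 (repr (toS1 x)) = toS1 x by exact: reprK.
by rewrite /cosS1 kE periodicz //; exact: cosD2pi.
Qed.

Lemma sinS1E (R : realType) (x : R) : sinS1 (toS1 x) = sin x.
Proof.
have /toS1_eqP[k kE] : toS1 (repr (toS1 x)) = toS1 x by exact: reprK.
by rewrite /sinS1 kE periodicz //; exact: sinD2pi.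
Qed.

Local Open Scope complex_scope.

Definition expi (R : realType) (x : R) : R[i] := cos x +i* sin x.

Definition expiS1 (R : realType) (psi : S1 R) : R[i] := cosS1 psi +i* sinS1 psi.

Record state (R : realType) := State { sz : R[i]; spsi : S1 R; sw : R }.

Definition tangent (R : realType) : Type := (R[i] * R * R)%type.

(* R[i] carries no normed module structure over R, so curves in the complex
   plane are differentiated componentwise. *)
Definition is_deriveC (R : realType) (z : R -> R[i]) (t : R) (v : R[i]) : Prop :=
  is_derive t 1 (fun s => complex.Re (z s)) (complex.Re v) /\
  is_derive t 1 (fun s => complex.Im (z s)) (complex.Im v).

(* Velocity of a curve in the circle, read off a local lift to the line. *)
Definition is_deriveS1 (R : realType) (psi : R -> S1 R) (t v : R) : Prop :=
  exists phi : R -> R,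
    (\forall s \near t, toS1 (phi s) = psi s) /\ is_derive t 1 phi v.

Definition solution (R : realType) (F : state R -> tangent R)
    (u : R -> state R) : Prop :=
  forall t, let: (vz, vpsi, vw) := F (u t) in
    [/\ is_deriveC (fun s => sz (u s)) t vz,
        is_deriveS1 (fun s => spsi (u s)) t vpsi
      & is_derive t 1 (fun s => sw (u s)) vw].

(* Uniqueness is part of the definition, so that u t is the flow Phi_t(u0). *)
Definition the_solution_from (R : realType) (F : state R -> tangent R)
    (u0 : state R) (u : R -> state R) : Prop :=
  [/\ solution F u, u 0 = u0
    & forall v, solution F v -> v 0 = u0 -> forall t, v t = u t].

Definition symmetry_action (R : realType) (Omega0 theta : R) (u : state R) : state R :=
  State (expi (Omega0 * theta) * sz u) (spsi u + toS1 (Omega0 * theta)) (sw u).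

Definition symmetry_orbit (R : realType) (Omega0 : R) (u : state R) : set (state R) :=
  [set symmetry_action Omega0 theta u | theta in [set: R]].

Definition relative_equilibrium (R : realType) (F : state R -> tangent R)
    (Omega0 : R) (u0 : state R) (xi : R) : Prop :=
  exists2 u : R -> state R, the_solution_from F u0 u
    & forall t, u t = symmetry_action Omega0 (xi * t) u0.

(* Points lying on nontrivial relative equilibria; the relative equilibria
   themselves are the symmetry orbits of these points.  When alphahat = PN = 0
   the w-component of vector_field vanishes identically and nontrivial relative
   equilibria occur in infinite families of distinct orbits. *)
Definition nontrivial_re (R : realType) (F : state R -> tangent R)
    (Omega0 : R) : set (state R) :=
  [set u | (exists xi, relative_equilibrium F Omega0 u xi) /\ sz u != 0].

Definition vector_field (R : realType)
    (eps Omega0 alphahat Delta Omega PN kappa q : R) (u : state R) : tangent R :=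
  ('i%C * Omega0%:C * sz u
     + eps%:C * (('i%C * Delta%:C - (alphahat / 2)%:C) * sz u
                 - (kappa * q / (2 * Omega0))%:C * expiS1 (spsi u)),
   Omega0 + eps * sw u,
   eps * (PN - alphahat * (Omega + sw u))).

Definition cross_section (R : realType) : set (state R) :=
  [set u | exists2 x : R, 0 < x & sz u = x%:C].

(* Main.v *)
(* On a relative equilibrium the flow is the rotation with angular velocity
   Omega0 xi, so the vector field at the point must be the infinitesimal rotation.
   Dividing by eps, this says
     Omega0 xi = Omega0 + eps w,   PN = alphahat (Omega + w),
     (alphahat / 2 + i (w - Delta)) z = - kappa q / (2 Omega0) e^(i psi).
   Conversely, by equivariance these equations make the rotating curve a solution,
   and it is the only one: the difference of two solutions solves linear equations
   that are triangular in w, then e^(i psi), then z.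
   If alphahat <> 0 the second equation fixes w, and the third determines z from
   psi, so the solutions form one symmetry orbit, with z = 0 iff kappa q = 0. *)

Require Import Defs.
From mathcomp Require Import all_boot all_order all_algebra.
From mathcomp Require Import all_classical all_reals all_analysis.
From mathcomp Require Import complex ring lra.

Set Implicit Arguments.
Unset Strict Implicit.
Unset Printing Implicit Defensive.

Import Order.TTheory GRing.Theory Num.Theory numFieldNormedType.Exports.

Local Open Scope classical_set_scope.
Local Open Scope ring_scope.
Local Open Scope complex_scope.

(** * Uniqueness for linear differential equations *)

Lemma is_derive_mull (R : realType) (k t : R) :
  is_derive t 1 (fun s : R => k * s) k.
Proof.
by apply: (is_derive_eq (is_deriveZ k (is_derive_id t 1))); rewrite /GRing.scale /= mulr1.
Qed.

(** The integrating factor [expR (- p * s)] makes the product with [f] constant, and an exponential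
    never vanishes. *)
Lemma linear_ode_eq0 (R : realType) (p : R) (f : R -> R) :
  (forall t : R, is_derive t 1 f (p * f t)) -> f 0 = 0 -> forall t, f t = 0.
Proof.
move=> df f0 t; pose g (s : R) := expR (- p * s) * f s.
have dg (s : R) : is_derive s 1 g 0.
  have d1 := is_derive1_comp (is_derive_expR (- p * s)) (is_derive_mull (- p) s).
  apply: (is_derive_eq (is_deriveM d1 (df s))).
  by rewrite /GRing.scale /=; ring.
have := is_derive_0_is_cst t 0 dg; rewrite /g f0 mulr0 => /eqP.
by rewrite mulf_eq0 gt_eqF ?expR_gt0 //= => /eqP.
Qed.

(* The squared norm satisfies N' = 2 p N, whatever the angular speed. *)
Lemma planar_ode_eq0 (R : realType) (p : R) (om a b : R -> R) :
  (forall t : R, is_derive t 1 a (p * a t - om t * b t)) ->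
  (forall t : R, is_derive t 1 b (p * b t + om t * a t)) ->
  a 0 = 0 -> b 0 = 0 -> forall t, a t = 0 /\ b t = 0.
Proof.
move=> da db a0 b0 t.
pose N (s : R) := a s * a s + b s * b s.
have dN (s : R) : is_derive s 1 N (2 * p * N s).
  have dN := is_deriveD (is_deriveM (da s) (da s)) (is_deriveM (db s) (db s)).
  by apply: (is_derive_eq dN); rewrite /GRing.scale /= /N; ring.
have N0 : N 0 = 0 by rewrite /N a0 b0 mulr0 addr0.
have /eqP := linear_ode_eq0 dN N0 t.
rewrite /N -!expr2 paddr_eq0 ?sqr_ge0 // !sqrf_eq0.
by case/andP=> /eqP-> /eqP->.
Qed.

(** * Angles and velocities on the circle *)

Lemma is_derive_cosS1 (R : realType) (psi : R -> S1 R) (t v : R) :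
  is_deriveS1 psi t v ->
  is_derive t 1 (fun s => cosS1 (psi s)) (- sinS1 (psi t) * v).
Proof.
move=> [phi [near_phi dphi]].
rewrite -(nbhs_singleton near_phi) sinS1E.
apply: near_eq_is_derive (is_derive1_comp (is_derive_cos (phi t)) dphi).
by near=> s; rewrite -(near near_phi s _) ?cosS1E //; near: s.
Unshelve. all: end_near. Qed.

Lemma is_derive_sinS1 (R : realType) (psi : R -> S1 R) (t v : R) :
  is_deriveS1 psi t v ->
  is_derive t 1 (fun s => sinS1 (psi s)) (cosS1 (psi t) * v).
Proof.
move=> [phi [near_phi dphi]].
rewrite -(nbhs_singleton near_phi) cosS1E.
apply: near_eq_is_derive (is_derive1_comp (is_derive_sin (phi t)) dphi).
by near=> s; rewrite -(near near_phi s _) ?sinS1E //; near: s.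
Unshelve. all: end_near. Qed.

Lemma cos2Dsin2S1 (R : realType) (psi : S1 R) :
  cosS1 psi ^+ 2 + sinS1 psi ^+ 2 = 1.
Proof. exact: cos2Dsin2. Qed.

(** Two lifts need not be compared: the derivatives of cosine and sine along the curve determine
    [sin * v] and [cos * v], and [cos^2 + sin^2 = 1] recovers [v]. *)
Lemma is_deriveS1_unique (R : realType) (psi : R -> S1 R) (t v v' : R) :
  is_deriveS1 psi t v -> is_deriveS1 psi t v' -> v = v'.
Proof.
move=> dv dv'.
have c : - sinS1 (psi t) * v = - sinS1 (psi t) * v'.
  by rewrite -(@derive_val _ _ _ _ _ _ _ (is_derive_cosS1 dv))
             -(@derive_val _ _ _ _ _ _ _ (is_derive_cosS1 dv')).
have s : cosS1 (psi t) * v = cosS1 (psi t) * v'.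
  by rewrite -(@derive_val _ _ _ _ _ _ _ (is_derive_sinS1 dv))
             -(@derive_val _ _ _ _ _ _ _ (is_derive_sinS1 dv')).
rewrite -[v]mul1r -[v']mul1r -(cos2Dsin2S1 (psi t)) !mulrDl !expr2 -!mulrA s.
by rewrite -[sinS1 _ * v]opprK -mulNr c mulNr opprK.
Qed.

(** Reduce [x] to [r] in [[0, 2 pi)]. The half-angle formula gives [sin (r / 2) = 0], while sine is
    positive on [(0, pi)], so [r = 0]. *)
Lemma cos_eq1 (R : realType) (x : R) : cos x = 1 -> toS1 x = toS1 0.
Proof.
move=> cx; have pi2 : (0 < pi *+ 2 :> R) by rewrite mulrn_wgt0 ?pi_gt0.
pose k := Num.floor (x / (pi *+ 2)); pose r := x - k%:~R * (pi *+ 2).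
have xE : x = r + k%:~R * (pi *+ 2) by rewrite subrK.
have cr : cos r = 1 by rewrite -cx xE periodicz //; exact: cosD2pi.
have /andP[r0 r2] : 0 <= r < pi *+ 2.
  have /andP[] := floor_itv (x / (pi *+ 2)).
  rewrite ler_pdivlMr // ltr_pdivrMr // -/k intrD mulrDl mul1r => h1 h2.
  by rewrite /r subr_ge0 h1 ltrBlDl.
have : sin (r / 2) = 0.
  apply/eqP; rewrite -sqrf_eq0; apply/eqP.
  move: cr; have {1}-> : r = (r / 2) *+ 2 by rewrite -mulr_natr divfK.
  by rewrite cos_mulr2n cos2sin2 => h; lra.
have [/sin_gt0_pi|] := boolP (0 < r / 2 < pi); first by move=> /lt0r_neq0/eqP.
rewrite negb_and -!leNgt => /orP[h _|h]; last by exfalso; rewrite mulr2n in r2; lra.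
by apply/toS1_eqP; exists k; rewrite {1}xE; congr (_ + _); lra.
Qed.

(** The difference of the representatives has cosine [cos^2 + sin^2 = 1]. *)
Lemma S1_inj (R : realType) (psi psi' : S1 R) :
  cosS1 psi = cosS1 psi' -> sinS1 psi = sinS1 psi' -> psi = psi'.
Proof.
rewrite /cosS1 /sinS1 => c s.
have := @cos_eq1 _ (repr psi - repr psi').
rewrite cosB c s -!expr2 cos2Dsin2 => /(_ erefl) h.
have reprE (x : S1 R) : x = toS1 (repr x) by rewrite /toS1 reprK.
by rewrite (reprE psi) -[repr psi](subrK (repr psi')) toS1D h -toS1D add0r -reprE.
Qed.

Lemma angle_exists (R : realType) (c s : R) : c ^+ 2 + s ^+ 2 = 1 ->
  exists x : R, cos x = c /\ sin x = s.
Proof.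
move=> h; have c1 : -1 <= c <= 1.
  by have := sqr_ge0 s; have := sqr_ge0 c; rewrite !expr2 in h *; nra.
have [_ ca] := acos_def c1.
have sa : sin (acos c) = `|s| by rewrite sin_acos // -h addrC addKr sqrtr_sqr.
(* The arccosine has nonnegative sine, so the sign of [s] selects [acos c] or its opposite. *)
have [s0|s0] := leP 0 s.
  by exists (acos c); rewrite ca sa ger0_norm.
by exists (- acos c); rewrite cosN sinN ca sa ltr0_norm // opprK.
Qed.

(** * Uniqueness of solutions of the system *)

(** In real coordinates the part linear in [z] has the form required by [planar_ode_eq0], and the
    forcing depends on [psi] alone. *)
Lemma vector_field_planar (R : realType)
    (eps Omega0 alphahat Delta Omega PN kappa q : R) (u : state R) :
  let a := complex.Re (sz u) in let b := complex.Im (sz u) in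
  let K := kappa * q / (2 * Omega0) in
  vector_field eps Omega0 alphahat Delta Omega PN kappa q u =
    ((- (eps * alphahat / 2) * a - (Omega0 + eps * Delta) * b
        - eps * K * cosS1 (spsi u))
     +i* (- (eps * alphahat / 2) * b + (Omega0 + eps * Delta) * a
        - eps * K * sinS1 (spsi u)),
     Omega0 + eps * sw u, eps * (PN - alphahat * (Omega + sw u))).
Proof.
case: u => [[a b] psi w] /=; rewrite /vector_field /=; congr (_, _, _).
by apply/eqP; rewrite eq_complex /=; apply/andP; split; apply/eqP; ring.
Qed.

Lemma vector_field_solution_unique (R : realType)
    (eps Omega0 alphahat Delta Omega PN kappa q : R) (u v : R -> state R) :
  let F := vector_field eps Omega0 alphahat Delta Omega PN kappa q in
  solution F u -> solution F v -> u 0 = v 0 -> forall t, u t = v t.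
Proof.
rewrite /= /solution => su sv uv0.
have wE t : sw (u t) = sw (v t).
  pose y (s : R) := sw (u s) - sw (v s).
  have dy (s : R) : is_derive s 1 y (- (eps * alphahat) * y s).
    move: (su s) (sv s); rewrite !vector_field_planar => -[_ _ du] [_ _ dv].
    by apply: (is_derive_eq (is_deriveB du dv)); rewrite /y; ring.
  have y0 : y 0 = 0 by rewrite /y uv0 subrr.
  by apply/eqP; rewrite -subr_eq0; apply/eqP/(linear_ode_eq0 dy y0).
have psiE t : spsi (u t) = spsi (v t).
  pose a (s : R) := cosS1 (spsi (u s)) - cosS1 (spsi (v s)).
  pose b (s : R) := sinS1 (spsi (u s)) - sinS1 (spsi (v s)).
  (* Once the [w] agree, both unit vectors e^(i psi) turn at the same time-dependent speed, so their
     difference does too, with growth rate 0. *)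
  pose om (s : R) := Omega0 + eps * sw (v s).
  have da (s : R) : is_derive s 1 a (0 * a s - om s * b s).
    move: (su s) (sv s); rewrite !vector_field_planar wE => -[_ du _] [_ dv _].
    apply: (is_derive_eq (is_deriveB (is_derive_cosS1 du) (is_derive_cosS1 dv))).
    by rewrite /a /b /om; ring.
  have db (s : R) : is_derive s 1 b (0 * b s + om s * a s).
    move: (su s) (sv s); rewrite !vector_field_planar wE => -[_ du _] [_ dv _].
    apply: (is_derive_eq (is_deriveB (is_derive_sinS1 du) (is_derive_sinS1 dv))).
    by rewrite /a /b /om; ring.
  have a0 : a 0 = 0 by rewrite /a uv0 subrr.
  have b0 : b 0 = 0 by rewrite /b uv0 subrr.
  have [/eqP + /eqP] := planar_ode_eq0 da db a0 b0 t.
  by rewrite !subr_eq0 => /eqP + /eqP; exact: S1_inj.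
have zE t : sz (u t) = sz (v t).
  pose a (s : R) := complex.Re (sz (u s)) - complex.Re (sz (v s)).
  pose b (s : R) := complex.Im (sz (u s)) - complex.Im (sz (v s)).
  (* Since the angles agree, the forcing cancels in the difference. *)
  pose p := - (eps * alphahat / 2).
  pose om (s : R) := Omega0 + eps * Delta.
  have da (s : R) : is_derive s 1 a (p * a s - om s * b s).
    move: (su s) (sv s); rewrite !vector_field_planar psiE.
    move=> -[[du _] _ _] [[dv _] _ _].
    by apply: (is_derive_eq (is_deriveB du dv)); rewrite /a /b /om /p /=; ring.
  have db (s : R) : is_derive s 1 b (p * b s + om s * a s).
    move: (su s) (sv s); rewrite !vector_field_planar psiE.
    move=> -[[_ du] _ _] [[_ dv] _ _].
    by apply: (is_derive_eq (is_deriveB du dv)); rewrite /a /b /om /p /=; ring.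
  have a0 : a 0 = 0 by rewrite /a uv0 subrr.
  have b0 : b 0 = 0 by rewrite /b uv0 subrr.
  have [/eqP + /eqP] := planar_ode_eq0 da db a0 b0 t.
  by rewrite !subr_eq0 => ha hb; apply/eqP; rewrite eq_complex ha hb.
by move=> t; move: (zE t) (psiE t) (wE t); case: (u t) (v t) => [? ? ?] [? ? ?] /= -> -> ->.
Qed.

(** * Rotations and the symmetry action *)

Lemma expiD (R : realType) (x y : R) : expi (x + y) = expi x * expi y.
Proof.
by rewrite /expi cosD sinD; apply/eqP; rewrite eq_complex /= eqxx /= addrC.
Qed.

Lemma expiS1_toS1 (R : realType) (x : R) : expiS1 (toS1 x) = expi x.
Proof. by rewrite /expiS1 cosS1E sinS1E. Qed.

Lemma toS1_repr (R : realType) (psi : S1 R) : toS1 (repr psi) = psi.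
Proof. by rewrite /toS1 reprK. Qed.

Lemma expiS1D (R : realType) (psi : S1 R) (x : R) :
  expiS1 (psi + toS1 x) = expi x * expiS1 psi.
Proof. by rewrite -[psi]toS1_repr -toS1D !expiS1_toS1 expiD mulrC. Qed.

Lemma expi_neq0 (R : realType) (x : R) : expi x != 0.
Proof.
apply/eqP => /eqP; rewrite eq_complex /= => /andP[/eqP c /eqP s].
by have /eqP := cos2Dsin2 x; rewrite c s expr0n addr0 eq_sym oner_eq0.
Qed.

Lemma is_derive_rotation (R : realType) (om : R) (z : R[i]) (t : R) :
  is_deriveC (fun s => expi (om * s) * z) t ('i%C * om%:C * (expi (om * t) * z)).
Proof.
have dc := is_derive1_comp (is_derive_cos (om * t)) (is_derive_mull om t).
have ds := is_derive1_comp (is_derive_sin (om * t)) (is_derive_mull om t).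
case: z => a b; split=> /=.
- have d := is_deriveB (is_deriveM dc (is_derive_cst a t 1))
    (is_deriveM ds (is_derive_cst b t 1)).
  by apply: (is_derive_eq d); rewrite /GRing.scale /=; ring.
- have d := is_deriveD (is_deriveM dc (is_derive_cst b t 1))
    (is_deriveM ds (is_derive_cst a t 1)).
  by apply: (is_derive_eq d); rewrite /GRing.scale /=; ring.
Qed.

Lemma is_deriveS1_rotation (R : realType) (om : R) (psi : S1 R) (t : R) :
  is_deriveS1 (fun s => psi + toS1 (om * s)) t om.
Proof.
exists (fun s => repr psi + om * s); split.
  by near=> s; rewrite toS1D toS1_repr.
apply: (is_derive_eq (is_deriveD (is_derive_cst (repr psi) t 1) (is_derive_mull om t))).
by rewrite add0r.
Unshelve. all: end_near. Qed.

Lemma expi0 (R : realType) : expi 0 = 1 :> R[i].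
Proof. by rewrite /expi cos0 sin0. Qed.

Lemma symmetry_action0 (R : realType) (Omega0 : R) (u : state R) :
  symmetry_action Omega0 0 u = u.
Proof.
case: u => z psi w; rewrite /symmetry_action mulr0 expi0 mul1r /=.
by rewrite -[psi]toS1_repr -toS1D addr0.
Qed.

Lemma symmetry_actionD (R : realType) (Omega0 s t : R) (u : state R) :
  symmetry_action Omega0 (s + t) u =
    symmetry_action Omega0 s (symmetry_action Omega0 t u).
Proof.
by rewrite /symmetry_action /= mulrDr expiD -mulrA -addrA -toS1D [X in toS1 X]addrC.
Qed.

Lemma symmetry_orbit_refl (R : realType) (Omega0 : R) (u : state R) :
  symmetry_orbit Omega0 u u.
Proof. by exists 0 => //; exact: symmetry_action0. Qed.

Lemma symmetry_orbit_eq (R : realType) (Omega0 : R) (u v : state R) :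
  symmetry_orbit Omega0 u v -> symmetry_orbit Omega0 v = symmetry_orbit Omega0 u.
Proof.
move=> [th _ <-]; apply/seteqP; split=> _ [t _ <-].
  by exists (t + th) => //; rewrite symmetry_actionD.
by exists (t - th) => //; rewrite -symmetry_actionD subrK.
Qed.

Lemma is_deriveC_unique (R : realType) (z : R -> R[i]) (t : R) (v v' : R[i]) :
  is_deriveC z t v -> is_deriveC z t v' -> v = v'.
Proof.
move=> [r i] [r' i']; apply/eqP; rewrite eq_complex.
rewrite -(@derive_val _ _ _ _ _ _ _ r) -(@derive_val _ _ _ _ _ _ _ i).
by rewrite (@derive_val _ _ _ _ _ _ _ r') (@derive_val _ _ _ _ _ _ _ i') !eqxx.
Qed.

Lemma vector_field_equivariant (R : realType)
    (eps Omega0 alphahat Delta Omega PN kappa q theta : R) (u : state R) :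
  let F := vector_field eps Omega0 alphahat Delta Omega PN kappa q in
  F (symmetry_action Omega0 theta u) =
    (expi (Omega0 * theta) * (F u).1.1, (F u).1.2, (F u).2).
Proof.
rewrite /= /vector_field /= expiS1D; congr (_, _, _); ring.
Qed.

(** * Algebraic characterization of relative equilibria *)

Lemma relative_equilibriumP (R : realType)
    (eps Omega0 alphahat Delta Omega PN kappa q : R) (u : state R) (xi : R) :
  eps != 0 ->
  let F := vector_field eps Omega0 alphahat Delta Omega PN kappa q in
  relative_equilibrium F Omega0 u xi <->
  [/\ Omega0 * xi = Omega0 + eps * sw u,
      PN = alphahat * (Omega + sw u)
    & ((alphahat / 2)%:C + 'i%C * (sw u - Delta)%:C) * sz u =
      - (kappa * q / (2 * Omega0))%:C * expiS1 (spsi u)].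
Proof.
move=> eps0 F; have epsC0 : eps%:C != 0 :> R[i] by rewrite fmorph_eq0.
pose om := Omega0 * xi.
pose c (t : R) := symmetry_action Omega0 (xi * t) u.
have cE t : c t = State (expi (om * t) * sz u) (spsi u + toS1 (om * t)) (sw u).
  by rewrite /c /symmetry_action mulrA.
have dz t := is_derive_rotation om (sz u) t.
have dpsi t := is_deriveS1_rotation om (spsi u) t.
have zE : (fun s => sz (c s)) = fun s => expi (om * s) * sz u.
  by apply/funext => s; rewrite cE.
have psiE : (fun s => spsi (c s)) = fun s => spsi u + toS1 (om * s).
  by apply/funext => s; rewrite cE.
have wE : (fun s => sw (c s)) = cst (sw u) by apply/funext => s; rewrite cE.
have c0 : c 0 = u by rewrite /c mulr0 symmetry_action0.
(* The bridge between dynamics and algebra: the vector field at [u] is the velocity at time 0 of the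
   rotating curve [c]. *)
have FE : F u = ('i%C * om%:C * sz u, om, 0) <->
  [/\ om = Omega0 + eps * sw u, PN = alphahat * (Omega + sw u)
    & ((alphahat / 2)%:C + 'i%C * (sw u - Delta)%:C) * sz u =
      - (kappa * q / (2 * Omega0))%:C * expiS1 (spsi u)].
  split=> [[hz hom hw]|[hom hw hz]].
    split=> //.
      by apply: (mulfI eps0); apply/eqP; rewrite -subr_eq0 -mulrBr hw.
    apply: (mulfI epsC0); apply/eqP; rewrite -subr_eq0; apply/eqP.
    (* Zero is written as a difference of two equal terms, one of which is then replaced through
       [hz]; what remains is a polynomial identity. *)
    by rewrite -[RHS](subrr ('i%C * om%:C * sz u)) -{2}hz -hom; ring.
  rewrite /F /vector_field -hom -hw subrr mulr0; congr (_, _, _).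
  rewrite [in RHS]hom; apply/eqP; rewrite -subr_eq0; apply/eqP.
  rewrite -[RHS](mulr0 eps%:C).
  rewrite -(subrr (- (kappa * q / (2 * Omega0))%:C * expiS1 (spsi u))) -{2}hz.
  by ring.
rewrite -/om -FE; split=> [[v [sv v0 _] vc]|Fu].
  have {vc}vE : v = c by apply/funext.
  (* Time 0 suffices here, by uniqueness of derivatives in each component. *)
  move: (sv 0); rewrite vE c0; case: (F u) => [[vz vpsi] vw] [hz hpsi hw].
  rewrite zE in hz; rewrite psiE in hpsi; rewrite wE in hw.
  congr (_, _, _).
  - by rewrite (is_deriveC_unique hz (dz 0)) mulr0 expi0 mul1r.
  - exact: is_deriveS1_unique hpsi (dpsi 0).
  - by rewrite -(@derive_val _ _ _ _ _ _ _ hw) derive_cst.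
have sc : solution F c.
  (* Equivariance carries the velocity equation from [u] along the whole curve. *)
  have Fc t : F (c t) = ('i%C * om%:C * (expi (om * t) * sz u), om, 0).
    by rewrite [F _]vector_field_equivariant -/F Fu /= mulrCA (mulrA Omega0).
  by move=> t; rewrite Fc zE psiE wE; split=> //; exact: is_derive_cst.
exists c => //; split=> // v sv v0 t.
by apply: (vector_field_solution_unique sv sc); rewrite v0 c0.
Qed.

Unset Implicit Arguments.
Set Strict Implicit.
Set Printing Implicit Defensive.

Theorem theorem7p1 (R : realType)
    (eps Omega0 alphahat Delta Omega PN kappa q : R)
    (eps_gt0 : 0 < eps) (Omega0_gt0 : 0 < Omega0) :
  let F := vector_field eps Omega0 alphahat Delta Omega PN kappa q in
  let d : R := PN / alphahat - Omega - Delta in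
  let D : R := Num.sqrt (alphahat ^+ 2 + 4 * d ^+ 2) in
  let ws : R := PN / alphahat - Omega in
  let xs : R := `| kappa * q / (Omega0 * D) | in
  let xis : R := 1 + eps / Omega0 * ws in
  [/\ ~ (alphahat = 0 /\ PN = 0) ->
        ((exists u, nontrivial_re F Omega0 u)
           <-> alphahat != 0 /\ kappa * q != 0),
      (exists! O : set (state R),
          exists2 u, nontrivial_re F Omega0 u & O = symmetry_orbit Omega0 u)
        <-> alphahat != 0 /\ kappa * q != 0
    & alphahat != 0 -> kappa * q != 0 ->
      exists psis : S1 R,
        let uS := State xs%:C psis ws in
        [/\ cosS1 psis = - Num.sg (kappa * q) * (alphahat / D),
            sinS1 psis = - Num.sg (kappa * q) * (2 * d / D),
            cross_section uS /\ nontrivial_re F Omega0 uS,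
            forall xi, relative_equilibrium F Omega0 uS xi <-> xi = xis
          & nontrivial_re F Omega0 = symmetry_orbit Omega0 uS]].
Proof.
move=> F d D ws xs xis.
have eps0 : eps != 0 by rewrite gt_eqF.
have Om0 : Omega0 != 0 by rewrite gt_eqF.
have reP u xi := @relative_equilibriumP _ eps Omega0 alphahat Delta Omega PN
  kappa q u xi eps0.
pose M (w : R) : R[i] := (alphahat / 2)%:C + 'i%C * (w - Delta)%:C.
pose balance (u : state R) := PN = alphahat * (Omega + sw u) /\
  M (sw u) * sz u = - (kappa * q / (2 * Omega0))%:C * expiS1 (spsi u).
(* The equation for [xi] is always solvable because [Omega0] is nonzero, so only the other two
   constrain [u]. *)
have nreP u : nontrivial_re F Omega0 u <-> balance u /\ sz u != 0.
  split=> [[[xi /reP[_ hw hz]] z0]|[[hw hz] z0]]; first by [].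
  split=> //; exists ((Omega0 + eps * sw u) / Omega0); apply/reP; split=> //.
  by rewrite mulrC divfK.
have M0 w : alphahat != 0 -> M w != 0.
  move=> al0; apply/eqP => /eqP; rewrite eq_complex /= => /andP[/eqP + _].
  rewrite !(mul0r, mul1r, mulr0, subr0, addr0, oppr0) => /eqP.
  by rewrite mulf_eq0 invr_eq0 pnatr_eq0 orbF (negbTE al0).
have kq_neq0 u : alphahat != 0 -> nontrivial_re F Omega0 u -> kappa * q != 0.
  move=> al0 /nreP[[_ hz] z0]; apply/eqP => kq; move/eqP: hz.
  rewrite kq mul0r oppr0 mul0r mulf_eq0 (negbTE z0) orbF.
  exact/negP/M0.
(* The explicit description comes first: both existence claims are read off from it. *)
have main : alphahat != 0 -> kappa * q != 0 ->
      exists psis : S1 R,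
        let uS := State xs%:C psis ws in
        [/\ cosS1 psis = - Num.sg (kappa * q) * (alphahat / D),
            sinS1 psis = - Num.sg (kappa * q) * (2 * d / D),
            cross_section uS /\ nontrivial_re F Omega0 uS,
            forall xi, relative_equilibrium F Omega0 uS xi <-> xi = xis
          & nontrivial_re F Omega0 = symmetry_orbit Omega0 uS].
  move=> al0 kq0.
  have DD : 0 < alphahat ^+ 2 + 4 * d ^+ 2.
    by rewrite ltr_pwDl ?exprn_even_gt0 // mulr_ge0 ?sqr_ge0.
  have D0 : 0 < D by rewrite sqrtr_gt0.
  have D2 : D ^+ 2 = alphahat ^+ 2 + 4 * d ^+ 2 by rewrite sqr_sqrtr // ltW.
  have Dn0 : D != 0 by rewrite gt_eqF.
  set C := - Num.sg (kappa * q) * (alphahat / D).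
  set S := - Num.sg (kappa * q) * (2 * d / D).
  have sg2 : Num.sg (kappa * q) ^+ 2 = 1 by rewrite sqr_sg kq0.
  have CS : C ^+ 2 + S ^+ 2 = 1.
    transitivity (Num.sg (kappa * q) ^+ 2 * ((alphahat ^+ 2 + 4 * d ^+ 2) / D ^+ 2)).
      by rewrite /C /S; field.
    by rewrite sg2 D2 divff ?mulr1 // gt_eqF.
  have [x [cx sx]] := angle_exists CS.
  exists (toS1 x) => uS.
  have xs0 : 0 < xs.
    by rewrite normr_gt0 mulf_neq0 // invr_neq0 // mulf_neq0.
  have xsE : xs = Num.sg (kappa * q) * (kappa * q) / (Omega0 * D).
    rewrite /xs normrM normfV [`|Omega0 * D|]gtr0_norm ?mulr_gt0 //.
    by rewrite -normrEsg.
  (* As [ws - Delta = d], both sides of the complex equation equal [|kappa q| / (Omega0 D) *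
     (alphahat / 2 + i d)]. *)
  have buS : balance uS.
    split; first by rewrite /= /ws; field.
    rewrite /= /M expiS1_toS1 /expi cx sx -/d xsE /C /S; apply/eqP.
    rewrite eq_complex /=; apply/andP; split; apply/eqP.
      by rewrite /ws -/d; field; rewrite Dn0.
    by rewrite /ws -/d; field; rewrite Dn0.
  have nuS : nontrivial_re F Omega0 uS.
    by apply/nreP; split=> //; rewrite fmorph_eq0 gt_eqF.
  split=> //.
  - by rewrite cosS1E.
  - by rewrite sinS1E.
  - by split=> //; exists xs.
  - move=> xi; rewrite reP; case: buS => hw hz; split.
      case=> h _ _; apply: (mulfI Om0); rewrite h /xis /=; field.
      by [].
    by move=> ->; split=> //; rewrite /xis /=; field.
  apply/seteqP; split=> u.
    move=> /nreP[[hw hz] z0].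
    have wE : sw u = ws.
      by rewrite /ws hw; field.
    (* The parameter that turns the angle [x] of [uS] into that of [u]; the action rotates by
       [Omega0] times its parameter. *)
    exists ((repr (spsi u) - x) / Omega0) => //.
    have [_ hzS] := buS.
    rewrite /symmetry_action mulrCA mulfV // mulr1 /= -toS1D addrCA subrr addr0 toS1_repr.
    (* The balance equation determines [z] from the angle, since [M ws] can be cancelled. *)
    have -> : expi (repr (spsi u) - x) * xs%:C = sz u.
      apply: (mulfI (M0 ws al0)); rewrite -{2}wE hz -expiS1_toS1.
      rewrite mulrCA hzS /= mulrCA expiS1_toS1 -expiS1D -toS1D addrCA subrr addr0.
      by rewrite toS1_repr.
    by rewrite -wE; case: (u).
  move=> [th _ <-]; apply/nreP; case: buS => hw hz; split; last first.
    by rewrite mulf_neq0 ?expi_neq0 // fmorph_eq0 gt_eqF.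
  split=> //.
  by rewrite /symmetry_action /= expiS1D mulrCA hz mulrCA.
split=> //.
- move=> alPN; split=> [[u nu]|[al0 kq0]]; last first.
    by have [psis [_ _ [_ nuS] _ _]] := main al0 kq0; eexists; exact: nuS.
  (* If [alphahat = 0], the balance equation forces [PN = 0], the excluded case. *)
  have al0 : alphahat != 0.
    apply/eqP => al; apply: alPN; split=> //.
    by have /nreP[[-> _] _] := nu; rewrite al mul0r.
  by split=> //; exact: kq_neq0 nu.
split=> [[orb [[u nu orbE] orb_uniq]]|[al0 kq0]]; last first.
  have [psis] := main al0 kq0.
  set uS := State _ _ _ => -[_ _ [_ nuS] _ nE]; exists (symmetry_orbit Omega0 uS); split.
    by exists uS.
  by move=> _ [u nu ->]; rewrite (@symmetry_orbit_eq _ _ uS) // -nE.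
suff al0 : alphahat != 0 by split=> //; exact: kq_neq0 nu.
apply/eqP => al.
(* If alphahat = 0, then halving z while doubling w - Delta gives another orbit. *)
have [[hw hz] z0] := (nreP u).1 nu.
have PN0 : PN = 0 by rewrite hw al mul0r.
pose u' := State (sz u * (2^-1)%:C) (spsi u) (Delta + 2 * (sw u - Delta)).
have nu' : nontrivial_re F Omega0 u'.
  apply/nreP; split; last by rewrite mulf_neq0 // fmorph_eq0 invr_eq0 pnatr_eq0.
  split; first by rewrite al mul0r.
  rewrite /= -hz /M al mul0r; case: (sz u) => a b; apply/eqP; rewrite eq_complex /=.
  by apply/andP; split; apply/eqP; field.
have : symmetry_orbit Omega0 u u'.
  rewrite -orbE (orb_uniq (symmetry_orbit Omega0 u')); last by exists u'.
  exact: symmetry_orbit_refl.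
(* Cancelling [z] gives e^(i Omega0 th) = 1/2, which is not of modulus 1. The [w] components would
   not do, as they coincide when [sw u = Delta]. *)
move=> [th _ [/eqP]]; rewrite mulrC -subr_eq0 -mulrBr mulf_eq0 (negbTE z0) /=.
rewrite subr_eq0 eq_complex /= => /andP[/eqP c /eqP s] _.
by have := cos2Dsin2 (Omega0 * th); rewrite c s !expr2; lra.
Qed.
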